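(* (First Isomorphism Theorem) Let $(G,\alpha)$ be a Hom-group and let $H$ and $N$ be Hom-subgroups of $G$ with $N$ Hom-normal in $G$. Then: (1) $N\cap H$ is a Hom-normal subgroup of $H$; (2) $N$ is a Hom-normal subgroup of $NH$; (3) $H/(N\cap H)\cong NH/N$ as Hom-groups.
   Context: A Hom-group $(G,\alpha)$ is a set $G$ together with a distinguished element $1\in G$ (the unit), a bijective map $\alpha:G\to G$ and a binary operation $G\times G\to G$, $(g,h)\mapsto gh$, such that for all $g,h,k\in G$: (1) $\alpha(g)(hk)=(gh)\alpha(k)$; (2) $\alpha(gh)=\alpha(g)\alpha(h)$; (3) $g1=1g=\alpha(g)$; (4) there exists $g^{-1}\in G$ with $gg^{-1}=g^{-1}g=1$. A Hom-subgroup of a Hom-group $(G,\alpha)$ is a nonempty subset $H\subseteq G$ closed under the product such that $(H,\alpha)$ (with $\alpha$ restricted to a bijection $H\to H$) is itself a Hom-group under the product of $G$. It is Hom-normal if $gH=Hg$ for every $g\in G$, where $gH=\{gh\mid h\in H\}$ and $Hg=\{hg\mid h\in H\}$. For $N$ Hom-normal in $G$, $G/N$ denotes the Hom-group of left cosets $gN$, with product $(aN)(bN)=(ab)N$ and twisting map $\widetilde{\alpha}(aN)=\alpha(a)N$. $NH=\{nh\mid n\in N,\ h\in H\}$; for $H$ a Hom-subgroup and $N$ a Hom-normal subgroup of $G$, $NH$ is a Hom-subgroup of $G$. A homomorphism of Hom-groups $f:(G,\alpha)\to(G',\beta)$ is a map with $f(gk)=f(g)f(k)$ for all $g,k$ and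 $\beta(f(g))=f(\alpha(g))$ for all $g$; it is an isomorphism if bijective, and $\cong$ means that an isomorphism exists. *)

(* Defs.v *)
From mathcomp Require Import all_boot.
From mathcomp Require Import boolp classical_sets.

Set Implicit Arguments.
Unset Strict Implicit.
Unset Printing Implicit Defensive.

Local Open Scope classical_set_scope.

Record is_hom_group (T : Type) (e : T) (alpha : T -> T) (mul : T -> T -> T) :
    Prop := IsHomGroup {
  hg_bij : bijective alpha;
  hg_assoc : forall g h k, mul (alpha g) (mul h k) = mul (mul g h) (alpha k);
  hg_twistM : forall g h, alpha (mul g h) = mul (alpha g) (alpha h);
  hg_unit : forall g, mul g e = alpha g /\ mul e g = alpha g;
  hg_inv : forall g, exists g', mul g g' = e /\ mul g' g = e
}.

Record homGroup := HomGroup {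
  hom_carrier :> Type;
  hom_one : hom_carrier;
  twist : hom_carrier -> hom_carrier;
  hom_mul : hom_carrier -> hom_carrier -> hom_carrier;
  hom_axioms : is_hom_group hom_one twist hom_mul
}.
Arguments hom_one {h}.

Declare Scope hom_scope.
Delimit Scope hom_scope with hom.
Notation "1" := hom_one : hom_scope.
Notation "g * h" := (hom_mul g h) : hom_scope.
Local Open Scope hom_scope.

Definition hom_morphism (G G' : homGroup) (f : G -> G') : Prop :=
  (forall g k, f (g * k) = f g * f k) /\
  (forall g, twist (f g) = f (twist g)).

Definition hom_isomorphic (G G' : homGroup) : Prop :=
  exists f : G -> G', hom_morphism f /\ bijective f.

Section Subgroups.
Variable G : homGroup.
Implicit Types H K L N : set G.

Definition mul_closed H := forall g h, H g -> H h -> H (g * h).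
Definition twist_closed H := forall g, H g -> H (twist g).

Definition sub_mul H (mH : mul_closed H) (x y : H) : H :=
  exist _ (val x * val y) (mem_set (mH _ _ (set_valP x) (set_valP y))).
Definition sub_twist H (tH : twist_closed H) (x : H) : H :=
  exist _ (twist (val x)) (mem_set (tH _ (set_valP x))).

(* The unit of H is not assumed to be that of G; see hom_subgroup_unit. *)
Record is_hom_subgroup H : Prop := IsHomSubgroup {
  hs_nonempty : H !=set0;
  hs_mul : mul_closed H;
  hs_twist : twist_closed H;
  hs_group : exists e : H, is_hom_group e (sub_twist hs_twist) (sub_mul hs_mul)
}.

Record homSubgroup := HomSubgroup {
  sub_set :> set G;
  sub_axioms : is_hom_subgroup sub_set
}.

Definition lcoset (g : G) H : set G := [set g * h | h in H].
Definition rcoset H (g : G) : set G := [set h * g | h in H].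

Definition hom_normal H : Prop := forall g, lcoset g H = rcoset H g.

Definition hom_normal_subgroup H : Prop := is_hom_subgroup H /\ hom_normal H.

Definition prod_set N H : set G := [set n * h | n in N & h in H].

Definition cosets N : set (set G) := range (fun g => lcoset g N).

End Subgroups.

Section Theory.
Variable G : homGroup.
Implicit Types (g h k a b : G) (H N : set G).

Lemma hmulA g h k : twist g * (h * k) = (g * h) * twist k.
Proof. exact: (hg_assoc (hom_axioms G)). Qed.

Lemma twistM g h : twist (g * h) = twist g * twist h.
Proof. exact: (hg_twistM (hom_axioms G)). Qed.

Lemma hmulg1 g : g * 1 = twist g.
Proof. exact: (hg_unit (hom_axioms G) g).1. Qed.

Lemma hmul1g g : 1 * g = twist g.
Proof. exact: (hg_unit (hom_axioms G) g).2. Qed.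

Lemma hinv_ex g : exists g', g * g' = 1 /\ g' * g = 1.
Proof. exact: (hg_inv (hom_axioms G)). Qed.

Lemma twist_inj : injective (@twist G).
Proof. exact: bij_inj (hg_bij (hom_axioms G)). Qed.

Lemma hmulI g h k : g * h = g * k -> h = k.
Proof.
move=> e; have [g' [_ g'g]] := hinv_ex g.
have := congr1 (hom_mul (twist g')) e.
by rewrite !hmulA g'g !hmul1g => /twist_inj/twist_inj.
Qed.

Lemma twist1 : twist (1 : G) = 1.
Proof.
have [u [u1 _]] := hinv_ex 1; have tu : twist u = 1 by rewrite -hmul1g.
by have := twistM 1 u; rewrite u1 tu hmulg1 => /twist_inj/esym.
Qed.

Lemma hinv_left g h : g * h = 1 -> h * g = 1.
Proof.
by move=> gh; have [k [gk kg]] := hinv_ex g; rewrite (@hmulI g h k) // gk.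
Qed.

Lemma hom_subgroup_unit H (sH : is_hom_subgroup H) (e : H) :
  is_hom_group e (sub_twist (hs_twist sH)) (sub_mul (hs_mul sH)) -> val e = 1.
Proof.
move=> eH; have [/(congr1 val) /= ee _] := hg_unit eH e.
by apply: (@hmulI (val e)); rewrite hmulg1.
Qed.

Lemma hom_subgroup1 H : is_hom_subgroup H -> H 1.
Proof.
move=> sH; have [e eH] := hs_group sH.
by rewrite -(hom_subgroup_unit eH); exact: set_valP.
Qed.

Lemma hom_subgroup_inv H g : is_hom_subgroup H -> H g ->
  exists g', [/\ H g', g * g' = 1 & g' * g = 1].
Proof.
move=> sH Hg; have [e eH] := hs_group sH.
have [g' [gg' g'g]] := hg_inv eH (exist _ g (mem_set Hg)).
exists (val g'); rewrite -(hom_subgroup_unit eH).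
by split; [exact: set_valP|have := congr1 val gg'|have := congr1 val g'g].
Qed.

Lemma hom_subgroup_untwist H g : is_hom_subgroup H -> H g ->
  exists g', H g' /\ twist g' = g.
Proof.
move=> sH Hg; have [e eH] := hs_group sH; have [t _ tK] := hg_bij eH.
exists (val (t (exist _ g (mem_set Hg)))); split; first exact: set_valP.
by have := congr1 val (tK (exist _ g (mem_set Hg))).
Qed.

Lemma sub_hom_group H (mH : mul_closed H) (tH : twist_closed H) (H1 : H 1) :
  (forall g, H g -> exists g', H g' /\ g * g' = 1) ->
  (forall g, H g -> exists g', H g' /\ twist g' = g) ->
  is_hom_group (exist _ (1 : G) (mem_set H1) : H) (sub_twist tH) (sub_mul mH).
Proof.
move=> inv unt; split.
- have /choice[t tP] (x : H) : exists y : H, twist (val y) = val x.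
    have [y [Hy yx]] := unt _ (set_valP x).
    by exists (exist _ y (mem_set Hy)).
  exists t => x; apply: val_inj; last exact: tP.
  by apply: twist_inj; rewrite tP.
- by move=> g h k; apply: val_inj; exact: hmulA.
- by move=> g h; apply: val_inj; exact: twistM.
- by move=> g; split; apply: val_inj; [exact: hmulg1|exact: hmul1g].
- move=> g; have [h [Hh gh]] := inv _ (set_valP g).
  exists (exist _ h (mem_set Hh)).
  by split; apply: val_inj => //=; exact: hinv_left.
Qed.

Lemma is_hom_subgroupI H : mul_closed H -> twist_closed H -> H 1 ->
  (forall g, H g -> exists g', H g' /\ g * g' = 1) ->
  (forall g, H g -> exists g', H g' /\ twist g' = g) ->
  is_hom_subgroup H.
Proof.
move=> mH tH H1 inv unt; apply: (@IsHomSubgroup _ _ _ mH tH); first by exists 1.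
by exists (exist _ (1 : G) (mem_set H1)); exact: sub_hom_group.
Qed.

Lemma hom_normal_swap N g n : hom_normal N -> N n ->
  exists2 n', N n' & n * g = g * n'.
Proof.
move=> nN Nn; have : rcoset N g (n * g) by exists n.
by rewrite -nN => -[n' Nn' <-]; exists n'.
Qed.

Lemma hom_normal_swap' N g n : hom_normal N -> N n ->
  exists2 n', N n' & g * n = n' * g.
Proof.
move=> nN Nn; have : lcoset g N (g * n) by exists n.
by rewrite nN => -[n' Nn' <-]; exists n'.
Qed.

Lemma prod_set_subgroup N H : is_hom_subgroup N -> hom_normal N ->
  is_hom_subgroup H -> is_hom_subgroup (prod_set N H).
Proof.
move=> sN nN sH; apply: is_hom_subgroupI.
- move=> _ _ [n Nn [h Hh <-]] [n' Nn' [h' Hh' <-]].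
  have [n2 [Nn2 <-]] := hom_subgroup_untwist sN Nn'.
  have [h2 [Hh2 <-]] := hom_subgroup_untwist sH Hh'.
  have [h3 [Hh3 <-]] := hom_subgroup_untwist sH Hh.
  have [n5 [Nn5 <-]] := hom_subgroup_untwist sN Nn.
  have [n3 Nn3 e] := hom_normal_swap' h3 nN Nn2.
  exists (twist n5 * twist n3).
    by apply: (hs_mul sN); exact: (hs_twist sN).
  exists (twist (h3 * h2)).
    by apply: (hs_twist sH); exact: (hs_mul sH).
  by rewrite -(twistM n2) -!hmulA (hmulA h3) e -hmulA.
- move=> _ [n Nn [h Hh <-]]; rewrite twistM.
  by exists (twist n); [exact: (hs_twist sN)|exists (twist h) => //; exact: (hs_twist sH)].
- exists 1; first exact: hom_subgroup1.
  by exists 1; [exact: hom_subgroup1|rewrite hmulg1 twist1].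
- move=> _ [n Nn [h Hh <-]].
  have [h1 [Hh1 <-]] := hom_subgroup_untwist sH Hh.
  have [h' [Hh' hh' _]] := hom_subgroup_inv sH Hh1.
  have [n' [Nn' nn' _]] := hom_subgroup_inv sN Nn.
  have [n2 [Nn2 n2E]] := hom_subgroup_untwist sN Nn'.
  exists (twist (h' * n2)); split.
    have [n3 Nn3 ->] := hom_normal_swap' h' nN Nn2.
    rewrite twistM; exists (twist n3); first exact: (hs_twist sN).
    by exists (twist h') => //; exact: (hs_twist sH).
  by rewrite -hmulA (hmulA h1) hh' hmul1g -twistM n2E nn' twist1.
- move=> _ [n Nn [h Hh <-]].
  have [n' [Nn' <-]] := hom_subgroup_untwist sN Nn.
  have [h' [Hh' <-]] := hom_subgroup_untwist sH Hh.
  by exists (n' * h'); split; [exists n' => //; exists h'|rewrite twistM].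
Qed.

Lemma lcoset_eqP N : is_hom_subgroup N -> forall a b,
  lcoset a N = lcoset b N <-> exists2 n, N n & twist a = b * n.
Proof.
move=> sN; have sub a b n : N n -> twist a = b * n ->
    lcoset a N `<=` lcoset b N.
  move=> Nn e _ [m Nm <-].
  have [k [Nk kE]] := hom_subgroup_untwist sN (hs_mul sN Nn Nm).
  exists k => //; apply: twist_inj.
  by rewrite !twistM e -hmulA kE.
move=> a b; split.
  move=> e; have : lcoset a N (twist a).
    by exists 1; [exact: hom_subgroup1|exact: hmulg1].
  by rewrite e => -[n Nn <-]; exists n.
move=> [n Nn e]; apply/seteqP; split; first exact: (sub _ _ n).
have [n' [Nn' nn' _]] := hom_subgroup_inv sN Nn.
apply: (sub _ _ n') => //; apply: twist_inj.
by rewrite twistM e -hmulA nn' hmulg1.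
Qed.

End Theory.

Definition subHomGroup (G : homGroup) (H : homSubgroup G) : homGroup :=
  let sH := sub_axioms H in
  HomGroup (sub_hom_group (hs_mul sH) (hs_twist sH) (hom_subgroup1 sH)
    (fun g Hg => let: ex_intro g' (And3 Hg' gg' _) := hom_subgroup_inv sH Hg in
       ex_intro _ g' (conj Hg' gg'))
    (fun g Hg => hom_subgroup_untwist sH Hg)).

(* The subset L of G is a Hom-normal subgroup of the Hom-subgroup K of G: it is
   contained in K and, seen as a subset of the carrier of K, it is one. *)
Definition hom_normal_subgroup_of (G : homGroup) (K : homSubgroup G)
    (L : set G) : Prop :=
  L `<=` K /\
  @hom_normal_subgroup (subHomGroup K) [set x : K | L (val x)].

Definition prodHomSubgroup (G : homGroup) (N H : homSubgroup G)
    (nN : hom_normal N) : homSubgroup G :=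
  HomSubgroup (prod_set_subgroup (sub_axioms N) nN (sub_axioms H)).
Arguments prodHomSubgroup {G} N H nN.

Section Quotient.
Variables (G : homGroup) (N : set G).

Definition coset (g : G) : cosets N :=
  exist _ (lcoset g N) (mem_set (imageT (fun g => lcoset g N) g)).

Lemma coset_surj (A : cosets N) : exists g, coset g = A.
Proof. by have [g _ e] := set_valP A; exists g; exact: val_inj. Qed.

Definition coset_repr (A : cosets N) : G := sval (cid (coset_surj A)).

Lemma coset_reprK : cancel coset_repr coset.
Proof. by move=> A; rewrite /coset_repr; case: cid. Qed.

(* These operations use chosen representatives; coset_mulE and coset_twistE show
   that (aN)(bN) = (ab)N and that aN is sent to alpha(a)N for all a and b. *)
Definition coset_mul (A B : cosets N) : cosets N :=
  coset (coset_repr A * coset_repr B).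
Definition coset_twist (A : cosets N) : cosets N :=
  coset (twist (coset_repr A)).

Hypothesis nN : hom_normal_subgroup N.

Lemma coset_eqP a b : coset a = coset b <-> exists2 n, N n & twist a = b * n.
Proof.
rewrite -(lcoset_eqP nN.1).
by split=> [/(congr1 val)|e]; last exact: val_inj.
Qed.

Lemma coset_mulE a b : coset_mul (coset a) (coset b) = coset (a * b).
Proof.
rewrite /coset_mul.
have /coset_eqP[n Nn] := coset_reprK (coset a).
have /coset_eqP[m Nm] := coset_reprK (coset b).
move: (coset_repr _) (coset_repr _) => b' a' eb ea.
apply/coset_eqP; rewrite twistM ea eb.
have [/= sN nrm] := nN.
have [m2 [Nm2 <-]] := hom_subgroup_untwist sN Nm.
have [n2 [Nn2 <-]] := hom_subgroup_untwist sN Nn.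
have [t _ tK] := hg_bij (hom_axioms G).
have [n3 Nn3 e] := hom_normal_swap (t b) nrm Nn2.
exists (twist (n3 * m2)); first by apply: (hs_twist sN); exact: (hs_mul sN).
by rewrite -{1}(tK b) -twistM -hmulA (hmulA n2) e -hmulA tK hmulA.
Qed.

Lemma coset_twistE a : coset_twist (coset a) = coset (twist a).
Proof.
have /coset_eqP[n Nn e] := coset_reprK (coset a).
apply/coset_eqP; exists (twist n); first exact: (hs_twist nN.1).
by rewrite e twistM.
Qed.

Lemma coset_hom_group : is_hom_group (coset 1) coset_twist coset_mul.
Proof.
split.
- have [t tK tK'] := hg_bij (hom_axioms G).
  have tE a b : coset a = coset b -> coset (t a) = coset (t b).
    move=> /coset_eqP[n Nn e]; apply/coset_eqP.
    have [m [Nm mE]] := hom_subgroup_untwist nN.1 Nn.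
    by exists m => //; apply: (@twist_inj G); rewrite twistM !tK' e mE.
  exists (fun A => coset (t (coset_repr A))) => A.
    have [a <-] := coset_surj A; rewrite coset_twistE.
    by rewrite (tE _ (twist a)) ?tK // coset_reprK.
  by rewrite coset_twistE tK' coset_reprK.
- move=> A B C; have [a <-] := coset_surj A; have [b <-] := coset_surj B.
  by have [c <-] := coset_surj C; rewrite !(coset_twistE, coset_mulE) hmulA.
- move=> A B; have [a <-] := coset_surj A; have [b <-] := coset_surj B.
  by rewrite !(coset_twistE, coset_mulE) twistM.
- move=> A; have [a <-] := coset_surj A.
  by rewrite !(coset_twistE, coset_mulE) hmulg1 hmul1g.
- move=> A; have [a <-] := coset_surj A; have [b [ab ba]] := hinv_ex a.
  by exists (coset b); rewrite !coset_mulE ab ba.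
Qed.

Definition quotHomGroup : homGroup := HomGroup coset_hom_group.

End Quotient.

(* The quotient K/L for L a Hom-normal subgroup of K. *)
Definition quotSubgroup (G : homGroup) (K : homSubgroup G) (L : set G)
    (nL : hom_normal_subgroup_of K L) : homGroup :=
  quotHomGroup nL.2.

(* Main.v *)
Require Import Defs.
From mathcomp Require Import all_boot.
From mathcomp Require Import boolp classical_sets.
Local Open Scope classical_set_scope.

(** The inclusion of [H] in [NH] is a morphism; it pulls the normal subgroup
    [N] of [NH] back to [N `&` H], and it meets every coset of [N] in [NH]
    because a product [n * h] can be rewritten [h * n'] by normality.  A
    morphism with these two properties induces an isomorphism of the quotients
    ([quot_isomorphic]).

    As in groups, this rests on division: [b * z = y] can be solved for [z],
    although the twisted associativity only allows [b] to be cancelled at the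
    cost of two applications of the twisting map, which are then undone because
    that map is bijective on the group and on each of its Hom-subgroups.
    Division inside [H] shows that [N `&` H] is normal in [H]
    ([hom_normal_setI]); applied to [NH] in place of [H], the same lemma gives
    the normality of [N] in [NH], since [N] is contained in [NH]. *)

Set Implicit Arguments.
Unset Strict Implicit.
Local Open Scope hom_scope.

Lemma hdivl (G : homGroup) (b y : G) : exists z, b * z = y.
Proof.
have [t _ tK] := hg_bij (hom_axioms G).
have [c [bc _]] := hinv_ex (t b).
(* For t the inverse of the twist, b * (c * t (t y)) reassociates to
   (t b * c) * t y = 1 * t y = y. *)
by exists (c * t (t y)); rewrite -{1}(tK b) hmulA bc hmul1g !tK.
Qed.

Section Subgroup.
Variables (G : homGroup) (H : set G).
Hypothesis sH : is_hom_subgroup H.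

Lemma hom_subgroup_twist_mem x : H (twist x) -> H x.
Proof.
move=> /(hom_subgroup_untwist sH)[y [Hy /twist_inj <-]].
exact: Hy.
Qed.

(** If [g'] inverts [g], multiplying [g * x] by [twist g'] gives [x] twisted
    twice. *)
Lemma hom_subgroup_divl g x : H g -> H (g * x) -> H x.
Proof.
move=> /(hom_subgroup_inv sH)[g' [Hg' _ g'g]] Hgx.
do 2![apply: hom_subgroup_twist_mem].
rewrite -hmul1g -g'g -hmulA.
by apply: (hs_mul sH) => //; exact: (hs_twist sH).
Qed.

Lemma hom_subgroup_divr g x : H g -> H (x * g) -> H x.
Proof.
move=> /(hom_subgroup_inv sH)[g' [Hg' gg' _]] Hxg.
do 2![apply: hom_subgroup_twist_mem].
rewrite -hmulg1 -gg' hmulA.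
by apply: (hs_mul sH) => //; exact: (hs_twist sH).
Qed.

End Subgroup.

(** When [n * g = g * n'] with [g] and [n] in [H] and [n'] in [N], the element
    [n'] lies in [H] as well, by division in [H]. *)
Lemma hom_normal_setI (G : homGroup) (H N : homSubgroup G) :
  hom_normal N -> hom_normal_subgroup_of H (N `&` H).
Proof.
move=> nN; split; first by move=> x [].
have [sN sH] := (sub_axioms N, sub_axioms H).
split.
  apply: is_hom_subgroupI.
  - move=> x y [Nx Hx] [Ny Hy].
    by split; [exact: (hs_mul sN)|exact: (hs_mul sH)].
  - by move=> x [Nx Hx]; split; [exact: (hs_twist sN)|exact: (hs_twist sH)].
  - by split; exact: hom_subgroup1.
  - move=> x [Nx _]; have [y [Ny xy _]] := hom_subgroup_inv sN Nx.
    have Hy : (H : set G) y.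
      apply: (hom_subgroup_divl sH (g := val x)); first exact: set_valP.
      by rewrite xy; exact: hom_subgroup1.
    by exists (exist _ y (mem_set Hy)); split=> //; apply: val_inj.
  - move=> x [Nx _]; have [y [Ny yx]] := hom_subgroup_untwist sN Nx.
    have Hy : (H : set G) y.
      by apply: (hom_subgroup_twist_mem sH); rewrite yx; exact: set_valP.
    by exists (exist _ y (mem_set Hy)); split=> //; apply: val_inj.
move=> g; have Hg : (H : set G) (val g) by exact: set_valP.
apply/seteqP; split=> _ [n [Nn Hn] <-].
  have [n' Nn' e] := hom_normal_swap' (val g) nN Nn.
  have Hn' : (H : set G) n'.
    by apply: (hom_subgroup_divr sH Hg); rewrite -e; exact: (hs_mul sH).
  by exists (exist _ n' (mem_set Hn')); [|apply: val_inj].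
have [n' Nn' e] := hom_normal_swap (val g) nN Nn.
have Hn' : (H : set G) n'.
  by apply: (hom_subgroup_divl sH Hg); rewrite -e; exact: (hs_mul sH).
by exists (exist _ n' (mem_set Hn')); [|apply: val_inj].
Qed.

Section Product.
Variables (G : homGroup) (N H : homSubgroup G).

(** Multiplying by the unit twists, so an element of either factor is reached
    from its preimage under the twisting map. *)
Lemma sub_prod_setl : N `<=` prod_set N H.
Proof.
move=> _ /(hom_subgroup_untwist (sub_axioms N))[n [Nn <-]].
exists n => //; exists 1; last exact: hmulg1.
exact: hom_subgroup1 (sub_axioms H).
Qed.

Lemma sub_prod_setr : H `<=` prod_set N H.
Proof.
move=> _ /(hom_subgroup_untwist (sub_axioms H))[h [Hh <-]].
exists 1; first exact: hom_subgroup1 (sub_axioms N).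
by exists h => //; exact: hmul1g.
Qed.

End Product.

(** The induced map sends the coset of [a] to the coset of [f a]: the kernel
    hypothesis, through division in [G1], makes it well defined and injective,
    and the last hypothesis makes it surjective. *)
Lemma quot_isomorphic (G1 G2 : homGroup) (N1 : set G1) (N2 : set G2)
    (nN1 : hom_normal_subgroup N1) (nN2 : hom_normal_subgroup N2)
    (f : G1 -> G2) :
  hom_morphism f -> (forall a, N1 a <-> N2 (f a)) ->
  (forall b, exists a, coset N2 (f a) = coset N2 b) ->
  hom_isomorphic (quotHomGroup nN1) (quotHomGroup nN2).
Proof.
move=> [fM ft] fN f_surj.
have cosetE a b : coset N2 (f a) = coset N2 (f b) <-> coset N1 a = coset N1 b.
  split=> [/(coset_eqP nN2)|/(coset_eqP nN1)] [n Nn e].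
    have [m mE] := hdivl b (twist a).
    apply/(coset_eqP nN1); exists m => //; apply/fN.
    suff -> : f m = n by [].
    by apply: (@hmulI _ (f b)); rewrite -fM mE -ft.
  apply/(coset_eqP nN2); exists (f n); first exact/fN.
  by rewrite ft e fM.
pose F (A : quotHomGroup nN1) : quotHomGroup nN2 := coset N2 (f (coset_repr A)).
have FE a : F (coset N1 a) = coset N2 (f a).
  by apply/cosetE; rewrite coset_reprK.
exists F; split; first split.
- move=> A B; have [a <-] := coset_surj A; have [b <-] := coset_surj B.
  by rewrite /= coset_mulE // !FE coset_mulE // fM.
- move=> A; have [a <-] := coset_surj A.
  by rewrite /= coset_twistE // !FE coset_twistE // ft.
have [s sE] := choice f_surj.
exists (fun B => coset N1 (s (coset_repr B))) => A.
  by rewrite -[RHS]coset_reprK; apply/cosetE; rewrite sE coset_reprK.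
by rewrite FE sE coset_reprK.
Qed.

Theorem theorem5p12 (G : homGroup) (H N : homSubgroup G)
    (nN : hom_normal N) :
  exists (nNH1 : hom_normal_subgroup_of H (N `&` H))
         (nNH2 : hom_normal_subgroup_of (prodHomSubgroup N H nN) N),
    hom_isomorphic (quotSubgroup nNH1) (quotSubgroup nNH2).
Proof.
have nNH1 := @hom_normal_setI G H N nN.
have nNH2 : hom_normal_subgroup_of (prodHomSubgroup N H nN) N.
  have := @hom_normal_setI G (prodHomSubgroup N H nN) N nN.
  by rewrite setIidl //; exact: sub_prod_setl.
exists nNH1, nNH2.
pose incl (h : subHomGroup H) : subHomGroup (prodHomSubgroup N H nN) :=
  exist _ (val h) (mem_set (@sub_prod_setr G N H _ (set_valP h))).
apply: (@quot_isomorphic _ _ _ _ nNH1.2 nNH2.2 incl).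
- by split=> *; apply: val_inj.
- by move=> h; split=> [[]//|Nh]; split=> //; exact: set_valP.
move=> x; have [n Nn [h Hh hx]] := set_valP x.
have [n' Nn' e] := hom_normal_swap h nN Nn.
(* As twist x = twist h * twist n', the coset of x is that of twist h, in
   general not that of h. *)
have Hth := hs_twist (sub_axioms H) Hh.
exists (exist _ (twist h) (mem_set Hth)).
have Ntn := hs_twist (sub_axioms N) Nn'.
apply/esym/(coset_eqP nNH2.2).
exists (exist _ (twist n') (mem_set (@sub_prod_setl G N H _ Ntn))) => //.
by apply: val_inj; rewrite /= -hx e twistM.
Qed.
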